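(* Let $n=6k+3$ with $k\ge 6$, and let $P(n,3)$ be the generalized Petersen graph with vertex set $\{u_1,\dots,u_n,v_1,\dots,v_n\}$ and edge set $\{u_iu_{i+1},\,u_iv_i,\,v_iv_{i+3}:1\le i\le n\}$ (subscripts modulo $n$). Then $\dim(P(n,3))\ge 4$.
   Context: For a connected graph $G$, an ordered set $W=\{w_1,\dots,w_m\}\subseteq V(G)$ is a resolving set if the vectors $r(z|W)=(d(z,w_1),\dots,d(z,w_m))$ of shortest-path distances are pairwise distinct over all $z\in V(G)$. The metric dimension $\dim(G)$ is the minimum cardinality of a resolving set of $G$. *)

(* Defs.v *)
From mathcomp Require Import all_boot.

Set Implicit Arguments.
Unset Strict Implicit.
Unset Printing Implicit Defensive.

Section Metric.

Variables (T : finType) (e : rel T).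
Implicit Types (x y z : T) (m : nat) (W : seq T).

Definition has_walk m x y : bool :=
  [exists p : m.-tuple T, path e x p && (last x p == y)].

Fact dist_subproof x y : exists m, has_walk m x y || (m == #|T|).
Proof. by exists #|T|; rewrite eqxx orbT. Qed.

(* Shortest-path distance. A shortest walk has fewer than #|T| edges, so the  *)
(* cap #|T| is attained exactly when x and y are not connected.               *)
Definition dist x y : nat := ex_minn (dist_subproof x y).

Lemma dist_walk x y : connect e x y -> has_walk (dist x y) x y.
Proof.
case/connectP => p ep lp; case: (shortenP ep) lp => q eq uq _ lq.
have szq : size q < #|T|.
  by have := max_card (mem (x :: q)); rewrite (card_uniqP uq).
have wq : has_walk (size q) x y.
  by apply/existsP; exists (in_tuple q); rewrite /= eq lq eqxx.
rewrite /dist; case: ex_minnP => m /orP[] // /eqP -> min_m.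
by have := min_m (size q); rewrite wq leqNgt szq => /(_ isT).
Qed.

Lemma dist_min x y m : has_walk m x y -> dist x y <= m.
Proof. by move=> w; rewrite /dist; case: ex_minnP => k _; apply; rewrite w. Qed.

Lemma dist_eq0 x y : (dist x y == 0) = (x == y).
Proof.
apply/eqP/eqP => [|<-].
  rewrite /dist; case: ex_minnP => m + _ m0; rewrite {}m0.
  case/orP => [/existsP[p]|/eqP T0]; last by have := card0_eq (esym T0) x.
  by rewrite (tuple0 p) /= => /eqP.
apply/eqP; rewrite -leqn0; apply: dist_min; apply/existsP.
by exists [tuple]; rewrite /= eqxx.
Qed.

Definition metric_rep W z : seq nat := [seq dist z w | w <- W].

Definition resolving W : bool := uniq W && injectiveb (metric_rep W).

Lemma resolving_enum : resolving (enum T).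
Proof.
rewrite /resolving enum_uniq; apply/injectiveP => x y /eq_in_map /(_ x).
rewrite mem_enum => /(_ isT) xy.
have /eqP x0 : dist x x == 0 by rewrite dist_eq0.
by have := dist_eq0 y x; rewrite -xy x0 eqxx => /esym/eqP.
Qed.

Fact metric_dim_subproof : exists m, [exists W : m.-tuple T, resolving W].
Proof.
by exists (size (enum T)); apply/existsP; exists (in_tuple (enum T));
  apply: resolving_enum.
Qed.

Definition metric_dim : nat := ex_minn metric_dim_subproof.

End Metric.

Section Petersen.

Variables n j : nat.

(* [inl i] is u_i and [inr i] is v_i; indices are residues 0, ..., n - 1.     *)
Definition petersen_vertex : finType := ('I_n + 'I_n)%type.

Definition petersen_arc : rel petersen_vertex := fun x y =>
  match x, y with
  | inl a, inl b => b == a + 1 %[mod n]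
  | inl a, inr b => a == b
  | inr a, inr b => b == a + j %[mod n]
  | inr _, inl _ => false
  end.

Definition petersen : rel petersen_vertex :=
  fun x y => petersen_arc x y || petersen_arc y x.

Lemma petersen_sym : symmetric petersen.
Proof. by move=> x y; rewrite /petersen orbC. Qed.

Lemma petersen_irrefl : 1 < n -> ~~ (n %| j) -> irreflexive petersen.
Proof.
move=> n1 nj [] a; rewrite /petersen orbb /= -{1}(addn0 a) eqn_modDl mod0n.
  by rewrite modn_small.
by rewrite eq_sym; apply: negbTE.
Qed.

Lemma petersen_connected x y : connect petersen x y.
Proof.
have csym : connect_sym petersen := sym_connect_sym petersen_sym.
have uu : forall m (a b : 'I_n), b = a + m :> nat ->
    connect petersen (inl a) (inl b).
  elim=> [|m IHm] a b.
    by rewrite addn0 => /val_inj ->.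
  rewrite addnS => ba.
  have lc : a + m < n by rewrite -ba ltnW.
  apply: connect_trans (IHm a (Ordinal lc) erefl) (connect1 _).
  by rewrite /petersen /= ba addn1 eqxx.
have uc : forall a b : 'I_n, connect petersen (inl a) (inl b).
  move=> a b; case: (leqP a b) => [|/ltnW] ab; last rewrite csym.
    by apply: (uu (b - a)); rewrite subnKC.
  by apply: (uu (a - b)); rewrite subnKC.
have su : forall z, exists a, connect petersen z (inl a).
  case=> a; exists a; first exact: connect0.
  by apply: connect1; rewrite /petersen /= eqxx.
have [[a xa] [b yb]] := (su x, su y).
by apply: connect_trans xa (connect_trans (uc a b) _); rewrite csym.
Qed.

End Petersen.

Arguments petersen_arc : clear implicits.
Arguments petersen : clear implicits.

(* Main.v *)
Require Import Defs.
From mathcomp Require Import all_boot.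
From mathcomp Require Import zify.

(* Let n = 6k + 3. Since 3 divides n, distances in P(n,3) have a closed form  *)
(* in the difference of the indices. Put a landmark at index 0. Any two       *)
(* further landmarks leave some pair of vertices unresolved, and the pair can *)
(* be chosen from a fixed finite list of pairs lying around index 0 or around *)
(* the antipodal index 3k + 1: 21 pairs if the landmark at 0 is outer (any    *)
(* outer landmark may be put there), 8 pairs if all landmarks are inner.      *)
(* On each of these two windows the distance to a landmark depends, up to an  *)
(* additive constant, only on the residue mod 3 of its index as long as it    *)
(* stays away from the windows, so deleting multiples of 3 from the long      *)
(* stretches reduces everything to n = 39, where a finite check suffices.     *)

Set Implicit Arguments.
Unset Strict Implicit.
Unset Printing Implicit Defensive.

(** At most three landmarks never resolve: [three_landmarks] finds two distinct vertices that tie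
    for all three. [petersen_dist] identifies distance with the closed form [pdist]. By [gap_grown]
    and [pdist_grown], stretching the cycle of length 39 increases a landmark's distances to all
    vertices of one window by the same amount, so ties inside a window survive. [common_pair] lifts
    in this way the ties found for n = 39, where every listed pair ties for the base landmark and
    any two admissible companions share a listed pair. *)

(** * Distances certified by a potential function *)

Lemma has_walk_rcons (T : finType) (e : rel T) m x y z :
  has_walk e m x y -> e y z -> has_walk e m.+1 x z.
Proof.
case/existsP => p /andP[ep /eqP lp] eyz; apply/existsP.
by exists [tuple of rcons p z]; rewrite /= rcons_path ep lp eyz last_rcons eqxx.
Qed.

(** The Lipschitz condition bounds every walk from below, and descending through predecessors builds
    a walk of length [f z]. *)
Lemma dist_potential (T : finType) (e : rel T) (f : T -> nat) x :
    f x = 0 -> (forall y z, e y z -> f z <= (f y).+1) ->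
    (forall z, z != x -> exists2 y, e y z & f z = (f y).+1) ->
  dist e x =1 f.
Proof.
move=> fx0 f_lip f_pred z.
have walk : forall m y, f y = m -> has_walk e m x y.
  elim=> [|m IHm] y fy; have [yx|/f_pred[u euy fyu]] := eqVneq y x.
  - by apply/existsP; exists [tuple]; rewrite /= yx eqxx.
  - by rewrite fy in fyu.
  - by rewrite yx fx0 in fy.
  - by apply: has_walk_rcons euy; apply: IHm; move: fyu; rewrite fy => -[].
have f_path : forall p y, path e y p -> f (last y p) <= f y + size p.
  elim=> [|u p IHp] y /=; first by rewrite addn0.
  by case/andP=> /f_lip yu /IHp; lia.
have xz : connect e x z.
  have /existsP[p /andP[ep /eqP lp]] := walk (f z) z erefl.
  by apply/connectP; exists p.
apply/eqP; rewrite eqn_leq; apply/andP; split; first exact/dist_min/walk.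
have /existsP[p /andP[/f_path + /eqP lp]] := dist_walk xz.
by rewrite lp fx0 size_tuple.
Qed.

(** * The closed form: Lipschitz bounds and descent *)

(** Steps of 3 and of 1 needed to cover the difference, in the better direction. Overshooting by a
    step of 3 saves nothing: 3 - 1 costs two steps, as does 1 + 1. *)
Definition axis n t := minn (t %/ 3 + t %% 3) ((n - t) %/ 3 + (n - t) %% 3).

(* Distance from a vertex of kind b to one of kind c when the indices differ  *)
(* by t, where [true] means outer: either the walk stays on the outer cycle,  *)
(* or it takes inner edges, outer edges for the residue mod 3, and spokes.    *)
Definition pdist n (b c : bool) t :=
  match b, c with
  | true, true => minn (minn t (n - t)) (axis n t).+2
  | false, false => if t %% 3 == 0 then axis n t else (axis n t).+2
  | _, _ => (axis n t).+1
  end.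

Lemma divmod3 t :
  exists q r, [/\ r < 3, t = 3 * q + r, t %/ 3 = q & t %% 3 = r].
Proof. exists (t %/ 3), (t %% 3); split; lia. Qed.

(** The complementary arc has residue -r mod 3; for r = 1 this is 2, whence the extra [(r == 1)]. *)
Lemma axisE k q r : r < 3 -> q <= 2 * k ->
  axis (6 * k + 3) (3 * q + r) = minn (q + r) (2 * k + 1 - q + (r == 1)).
Proof. by rewrite /axis; case: r => [|[|[|//]]] _ qk; lia. Qed.

Lemma pdistE k b c q r : r < 3 -> q <= 2 * k ->
  pdist (6 * k + 3) b c (3 * q + r) =
  let a := minn (q + r) (2 * k + 1 - q + (r == 1)) in
  match b, c with
  | true, true => minn (minn (3 * q + r) (6 * k + 3 - (3 * q + r))) a.+2
  | false, false => if r == 0 then a else a.+2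
  | _, _ => a.+1
  end.
Proof.
move=> r3 qk; rewrite /pdist axisE //=.
by rewrite [3 * q]mulnC modnMDl modn_small.
Qed.

Definition step n d t t' := t' = t + d \/ t' + n = t + d.

Lemma pdist_rim k b t t' : t < 6 * k + 3 -> t' < 6 * k + 3 ->
  step (6 * k + 3) 1 t t' ->
  pdist (6 * k + 3) b true t' <= (pdist (6 * k + 3) b true t).+1 /\
  pdist (6 * k + 3) b true t <= (pdist (6 * k + 3) b true t').+1.
Proof.
have [q [r [r3 -> _ _]]] := divmod3 t.
have [q' [r' [r3' -> _ _]]] := divmod3 t'.
move=> h h' s.
rewrite !pdistE //; [|lia..].
have {h h' s} : r' = r.+1 /\ q' = q \/ r = 2 /\ r' = 0 /\
    (q' = q.+1 /\ q < 2 * k \/ q = 2 * k /\ q' = 0).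
  by rewrite /step in s; lia.
case=> [[? ?]|[? [? [[? ?]|[? ?]]]]]; subst.
- by case: r r3 r3' => [|[|//]] _ _; case: b => /=; lia.
- by case: b => /=; lia.
- by case: b => /=; lia.
Qed.

Lemma pdist_rail k b t t' : t < 6 * k + 3 -> t' < 6 * k + 3 ->
  step (6 * k + 3) 3 t t' ->
  pdist (6 * k + 3) b false t' <= (pdist (6 * k + 3) b false t).+1 /\
  pdist (6 * k + 3) b false t <= (pdist (6 * k + 3) b false t').+1.
Proof.
have [q [r [r3 -> _ _]]] := divmod3 t.
have [q' [r' [r3' -> _ _]]] := divmod3 t'.
move=> h h' s.
rewrite !pdistE //; [|lia..].
have [? {h h' s}] : r' = r /\
  (q' = q.+1 /\ q < 2 * k \/ q = 2 * k /\ q' = 0) by rewrite /step in s; lia.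
by subst r'; case: r r3 r3' => [|[|[|//]]] _ _; case: b => /=; lia.
Qed.

Lemma pdist_spoke k b t : t < 6 * k + 3 ->
  pdist (6 * k + 3) b true t <= (pdist (6 * k + 3) b false t).+1 /\
  pdist (6 * k + 3) b false t <= (pdist (6 * k + 3) b true t).+1.
Proof.
have [q [r [r3 -> _ _]]] := divmod3 t => h.
rewrite !pdistE //; [|lia..].
by case: r r3 h => [|[|[|//]]] _ h; case: b => /=; lia.
Qed.

(** Up to half the cycle, a spoke or a step towards index 0 always descends, so no wrap-around
    occurs; [pdist_opp] reflects this to the other half. *)
Lemma pdist_pred_half k b c t : t <= 3 * k + 1 -> b != c \/ t != 0 ->
  exists c' t',
    (c' = ~~ c /\ t' = t \/ c' = c /\ t = t' + (if c then 1 else 3)) /\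
    pdist (6 * k + 3) b c' t' < pdist (6 * k + 3) b c t.
Proof.
have [q [r [r3 -> _ _]]] := divmod3 t => h bc.
case: c bc => bc.
  case: b bc => bc.
    have [q0|q0] := posnP q.
      exists true, (3 * q + r.-1); split; first by right; lia.
      subst; rewrite !pdistE /=; do ?case: ifP; lia.
    exists false, (3 * q + r); split; first by left.
    rewrite !pdistE /=; do ?case: ifP; lia.
  have [r0|r0] := posnP r.
    exists false, (3 * q + r); split; first by left.
    rewrite !pdistE /=; do ?case: ifP; lia.
  exists true, (3 * q + r.-1); split; first by right; lia.
  by case: r r3 r0 h bc => [|[|[|//]]] // _ _ h bc; rewrite !pdistE /=; lia.
have [q0|q0] := posnP q.
  exists true, (3 * q + r); split; first by left.
  subst; rewrite !pdistE /=; case: b bc; do ?case: ifP; lia.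
have [[bf r0]|[bt|r0]] : ~~ b /\ r > 0 \/ b \/ r = 0 by lia.
- exists true, (3 * q + r); split; first by left.
  case: b bc bf => // bc _; rewrite !pdistE /=; do ?case: ifP; lia.
- exists false, (3 * q.-1 + r); split; first by right; lia.
  case: b bc bt => // bc _; rewrite !pdistE /=; do ?case: ifP; lia.
- exists false, (3 * q.-1 + r); split; first by right; lia.
  case: b bc => bc; rewrite !pdistE /=; do ?case: ifP; lia.
Qed.

Lemma pdist_opp k b c t : t <= 6 * k + 3 ->
  pdist (6 * k + 3) b c (6 * k + 3 - t) = pdist (6 * k + 3) b c t.
Proof.
move=> tn; have t3 : ((6 * k + 3 - t) %% 3 == 0) = (t %% 3 == 0) by lia.
rewrite /pdist /axis subKn // t3 [minn (_ - t) t]minnC.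
by rewrite [minn ((_ - t) %/ 3 + _) _]minnC.
Qed.

Lemma pdist_pred k b c t : t < 6 * k + 3 -> b != c \/ t != 0 ->
  let d := if c then 1 else 3 in
  exists c' t', [/\ t' < 6 * k + 3,
    c' = ~~ c /\ t' = t \/
      c' = c /\ (step (6 * k + 3) d t t' \/ step (6 * k + 3) d t' t)
    & pdist (6 * k + 3) b c' t' < pdist (6 * k + 3) b c t].
Proof.
move=> tn bc d.
have [th|th] := leqP t (3 * k + 1).
  have [c' [t' [e lt]]] := @pdist_pred_half k b c t th bc.
  exists c', t'; split=> //; rewrite /step /d; lia.
have [||c' [t' [e lt]]] := @pdist_pred_half k b c (6 * k + 3 - t); [lia..|].
(* The mirror image of 0 would be the index 6k + 3, out of range, so 0 itself is kept. *)
have [t0|t0] := posnP t'.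
  exists c', t'; rewrite pdist_opp in lt; last lia.
  split=> //; rewrite /step /d; lia.
exists c', (6 * k + 3 - t'); rewrite -pdist_opp in lt; last lia.
rewrite [in X in _ < X]pdist_opp in lt; last lia.
split=> //; rewrite /step /d; lia.
Qed.

(** * Indices, offsets and the distance formula in P(n,3) *)

Definition outer n (x : petersen_vertex n) : bool :=
  if x is inl _ then true else false.

Definition index n (x : petersen_vertex n) : nat :=
  match x with inl i | inr i => i end.

Definition vertex n (b : bool) (i : 'I_n) : petersen_vertex n :=
  if b then inl i else inr i.

Definition offset n (x y : petersen_vertex n) :=
  if index x <= index y then index y - index x else index y + n - index x.

Lemma index_lt n (x : petersen_vertex n) : index x < n.
Proof. by case: x => i /=. Qed.

Lemma petersenE n (n3 : 3 < n) (x y : petersen_vertex n) :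
  petersen n 3 x y <->
    outer y = ~~ outer x /\ index x = index y \/
    outer x = outer y /\
    let d := if outer x then 1 else 3 in
    (step n d (index x) (index y) \/ step n d (index y) (index x)).
Proof.
have modS d i j : d < n -> i < n -> j < n ->
    (j == i + d %[mod n]) <-> step n d i j.
  move=> dn i_n jn; rewrite (modn_small jn) /step.
  have [idn|nid] := ltnP (i + d) n; first by rewrite modn_small //; lia.
  rewrite -(subnK nid) modnDr modn_small; lia.
rewrite /petersen; case: x y => [i|i] [j|j] /=; rewrite -?val_eqE /=.
- have dn : 1 < n := ltnW (ltnW n3).
  have s1 := modS _ _ _ dn (ltn_ord i) (ltn_ord j).
  have s2 := modS _ _ _ dn (ltn_ord j) (ltn_ord i).
  split=> [/orP[/s1|/s2]|[[]|[_ [/s1|/s2] ->]]] //=; rewrite ?orbT //; tauto.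
- rewrite orbF; lia.
- lia.
- have dn : 3 < n := n3.
  have s1 := modS _ _ _ dn (ltn_ord i) (ltn_ord j).
  have s2 := modS _ _ _ dn (ltn_ord j) (ltn_ord i).
  split=> [/orP[/s1|/s2]|[[]|[_ [/s1|/s2] ->]]] //=; rewrite ?orbT //; tauto.
Qed.

Lemma offset_lt n (x y : petersen_vertex n) : offset x y < n.
Proof.
by rewrite /offset; have := index_lt x; have := index_lt y; case: ifP; lia.
Qed.

Lemma vertexP n (x y : petersen_vertex n) :
  outer x = outer y -> index x = index y -> x = y.
Proof. by case: x y => i [] j //= _ /val_inj ->. Qed.

Lemma offset_surj n (x : petersen_vertex n) b t :
  t < n -> exists y, outer y = b /\ offset x y = t.
Proof.
move=> tn; have xn := index_lt x.
have [h|h] := ltnP (index x + t) n.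
  exists (vertex b (Ordinal h)).
  by case: b; rewrite /offset /=; split=> //; case: ifP; lia.
have h' : index x + t - n < n by lia.
exists (vertex b (Ordinal h')).
by case: b; rewrite /offset /=; split=> //; case: ifP; lia.
Qed.

Lemma offset_stepE n d (x y z : petersen_vertex n) : d < n ->
  step n d (index y) (index z) <-> step n d (offset x y) (offset x z).
Proof.
rewrite /step /offset.
have := index_lt x; have := index_lt y; have := index_lt z.
do 2 case: ifP; lia.
Qed.

Lemma offset_inj n (x y z : petersen_vertex n) :
  offset x y = offset x z -> index y = index z.
Proof.
rewrite /offset; have := index_lt x; have := index_lt y; have := index_lt z.
do 2 case: ifP; lia.
Qed.

Lemma petersen_dist k (x y : petersen_vertex (6 * k + 3)) : 0 < k ->
  dist (petersen (6 * k + 3) 3) x y =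
  pdist (6 * k + 3) (outer x) (outer y) (offset x y).
Proof.
set n := 6 * k + 3 in x y *; move=> k0.
have [n1 n3] : 1 < n /\ 3 < n by lia.
pose f y := pdist n (outer x) (outer y) (offset x y).
have f_lip u v : petersen n 3 u v -> f v <= (f u).+1.
  rewrite /f => /(petersenE n3)[[ov iv]|[ouv]].
    have -> : offset x v = offset x u by rewrite /offset iv.
    have := @pdist_spoke k (outer x) (offset x u) (offset_lt x u).
    by rewrite ov -/n; case: (outer u) => -[].
  have un := offset_lt x u; have vn := offset_lt x v.
  rewrite ouv; case: (outer v) => /= -[] s.
  + by have [] := pdist_rim (outer x) un vn ((offset_stepE x u v n1).1 s).
  + by have [] := pdist_rim (outer x) vn un ((offset_stepE x v u n1).1 s).
  + by have [] := pdist_rail (outer x) un vn ((offset_stepE x u v n3).1 s).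
  + by have [] := pdist_rail (outer x) vn un ((offset_stepE x v u n3).1 s).
have x0 : offset x x = 0 by rewrite /offset leqnn subnn.
apply: (dist_potential (f := f)) => // [|v vx].
  by rewrite /f x0 /pdist /axis div0n mod0n !min0n; case: (outer x).
have [||c [t [tn ct lt_f]]] := @pdist_pred k (outer x) (outer v) (offset x v).
- exact: offset_lt.
- have [oxv|] := eqVneq (outer x) (outer v); [right|by left].
  apply: contra vx => /eqP v0; apply/eqP/vertexP => //.
  by apply: (@offset_inj _ x); rewrite x0.
have [u [ou tu]] := offset_surj x c tn.
subst c t; have euv : petersen n 3 u v.
  apply/(petersenE n3); case: ct => [[ou /offset_inj iu]|[ou s]].
    by left; rewrite ou negbK.
  right; split=> //; rewrite /= ou.
  have dn : (if outer v then 1 else 3) < n by case: (outer v).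
  by case: s => /(offset_stepE _ _ _ dn); auto.
(* The strict drop and [f_lip] together force a drop of exactly one. *)
by exists u => //; apply/eqP; rewrite eqn_leq f_lip.
Qed.

Definition gap i j := (i - j) + (j - i).

(** Rotation and reflection symmetry: all positions can be read off from one base vertex [x]. *)
Lemma pdist_offset k b c (x y z : petersen_vertex (6 * k + 3)) :
  pdist (6 * k + 3) b c (offset y z) =
  pdist (6 * k + 3) b c (gap (offset x y) (offset x z)).
Proof.
have yn := offset_lt x y; have zn := offset_lt x z.
have [->|oyz] : offset y z = gap (offset x y) (offset x z) \/
    offset y z = 6 * k + 3 - gap (offset x y) (offset x z).
  rewrite /offset /gap; have := index_lt x; have := index_lt y.
  by have := index_lt z; do 3 case: ifP; lia.
- by [].
- by rewrite oyz pdist_opp // /gap; lia.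
Qed.

Lemma gapC : commutative gap.
Proof. by move=> i j; rewrite /gap addnC. Qed.

Lemma petersen_distC k (x y : petersen_vertex (6 * k + 3)) : 0 < k ->
  dist (petersen (6 * k + 3) 3) x y = dist (petersen (6 * k + 3) 3) y x.
Proof.
move=> k0; rewrite !petersen_dist // (pdist_offset _ _ x x y).
by rewrite (pdist_offset _ _ x y x) gapC; case: (outer x); case: (outer y).
Qed.

(** * Transfer from the 39-cycle to longer cycles *)

(** From t = 3 on, a route along inner edges is no longer than the outer arc, so each added 3 costs
    one edge; for smaller t the outer arc may win, hence the restriction s = 0. *)
Lemma pdist_near_grow k m s b c t : s <= m -> t <= 3 * k + 1 ->
    3 <= t \/ s = 0 ->
  pdist (6 * (k + m) + 3) b c (t + 3 * s) = pdist (6 * k + 3) b c t + s.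
Proof.
have [q [r [r3 -> _ _]]] := divmod3 t => sm tk t3.
rewrite (_ : 3 * q + r + 3 * s = 3 * (q + s) + r); last lia.
rewrite !pdistE //; [|lia..].
by case: r r3 tk t3 => [|[|[|//]]] _ tk t3; case: b; case: c => /=; lia.
Qed.

Lemma pdist_far_grow k m s b c t u : s <= m -> t <= 6 * k + 3 ->
    3 * k + 2 <= t -> t + 3 <= 6 * k + 3 \/ s = 0 ->
    u + 3 * s = t + 6 * m ->
  pdist (6 * (k + m) + 3) b c u = pdist (6 * k + 3) b c t + s.
Proof.
move=> sm tn kt t3 ut.
have un : u <= 6 * (k + m) + 3 by lia.
rewrite -(pdist_opp b c un) -(pdist_opp b c tn).
have -> : 6 * (k + m) + 3 - u = 6 * k + 3 - t + 3 * s by lia.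
by apply: pdist_near_grow; lia.
Qed.

(* Sends the windows around 0 and 19 of the 39-cycle to the windows around 0  *)
(* and 19 + 3m of the cycle of length 39 + 6m.                                *)
Definition stretch m p :=
  if p < 10 then p else if p < 29 then p + 3 * m else p + 6 * m.

Definition near p := (p <= 3) || (36 <= p < 39).
Definition far p := 16 <= p <= 23.

(* Inverse to [stretch] near the windows; elsewhere it keeps the residue mod  *)
(* 3 of the index and the side from which the windows are seen.               *)
Definition zoom m t :=
  if t < 9 then t else if t < 12 + 3 * m then 9 + t %% 3
  else if t < 27 + 3 * m then t - 3 * m
  else if t < 30 + 6 * m then 27 + t %% 3 else t - 6 * m.

Lemma zoom_lt m t : t < 6 * (6 + m) + 3 -> zoom m t < 39.
Proof. by rewrite /zoom; do ?case: ifP; lia. Qed.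

(* The shorter arc grows by 3s when passing from the 39-cycle to the cycle of *)
(* length 39 + 6m.                                                            *)
Definition grown m s v u :=
  (v <= 19 /\ (3 <= v \/ s = 0) /\ u = v + 3 * s) \/
  (20 <= v <= 39 /\ (v <= 36 \/ s = 0) /\ u + 3 * s = v + 6 * m).

Lemma pdist_grown m s b c v u : s <= m -> grown m s v u ->
  pdist (6 * (6 + m) + 3) b c u = pdist 39 b c v + s.
Proof.
move=> sm [[v19 [v3 ->]]|[v20 [v36 uv]]]; first exact: (@pdist_near_grow 6).
by apply: (@pdist_far_grow 6); lia.
Qed.

(** The point is that [d] and [e] do not depend on [p]: one growth per window. *)
Lemma gap_grown m t : t < 6 * (6 + m) + 3 -> exists d e, [/\ d <= m, e <= m &
  forall p, (near p -> grown m d (gap (zoom m t) p) (gap t (stretch m p))) /\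
            (far p -> grown m e (gap (zoom m t) p) (gap t (stretch m p)))].
Proof.
move=> tn.
have stretch_near p : near p ->
    p <= 3 /\ stretch m p = p \/ 36 <= p < 39 /\ stretch m p = p + 6 * m.
  by rewrite /near /stretch; do ?case: ifP; lia.
have stretch_far p : far p -> 16 <= p <= 23 /\ stretch m p = p + 3 * m.
  by rewrite /far /stretch; do ?case: ifP; lia.
suff [d [e [dm em H]]] : exists d e, [/\ d <= m, e <= m &
    forall p, [/\ p <= 3 -> grown m d (gap (zoom m t) p) (gap t p),
      36 <= p < 39 -> grown m d (gap (zoom m t) p) (gap t (p + 6 * m))
      & 16 <= p <= 23 -> grown m e (gap (zoom m t) p) (gap t (p + 3 * m))]].
  exists d, e; split=> // p; have [H1 H2 H3] := H p; split.
    by case/stretch_near => -[? ->]; auto.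
  by case/stretch_far => ? ->; auto.
rewrite /zoom /gap /grown.
have [t9|t9] := ltnP t 9.
  exists 0, m; split=> // p; split; lia.
have [t12|t12] := ltnP t (12 + 3 * m).
  have [s [r [r3 et _ et3]]] := divmod3 (t - 9).
  have -> : t %% 3 = r by lia.
  have {et et3} ? : t = 9 + 3 * s + r by lia.
  subst t.
  (* Of the m multiples of 3 inserted on this side, s lie between 0 and the landmark and m - s
     between it and the far window. *)
  exists s, (m - s); split=> [||p]; [lia..|split; lia].
have [t27|t27] := ltnP t (27 + 3 * m).
  exists m, 0; split=> // p; split; lia.
have [t30|t30] := ltnP t (30 + 6 * m).
  have [s [r [r3 et _ et3]]] := divmod3 (t - (27 + 3 * m)).
  have -> : t %% 3 = r by lia.
  have {et et3} ? : t = 27 + 3 * m + 3 * s + r by lia.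
  subst t.
  exists (m - s), s; split=> [||p]; [lia..|split; lia].
exists 0, m; split=> // p; split; lia.
Qed.

(** * The finite check for n = 39 and its lifting *)

Definition vertex_pair : Type := (bool * nat) * (bool * nat).

Definition conflict b t (pq : vertex_pair) :=
  pdist 39 b pq.1.1 (gap t pq.1.2) == pdist 39 b pq.2.1 (gap t pq.2.2).

(** Both ends share a window, so that the same growth applies to both sides of a tie. *)
Definition valid (pq : vertex_pair) :=
  (near pq.1.2 && near pq.2.2 || far pq.1.2 && far pq.2.2) && (pq.1 != pq.2).

(* Both lists were found by a computer search for small hitting sets.         *)
Definition outer_pairs : seq vertex_pair :=
  [:: ((true, 1), (true, 38)); ((false, 0), (true, 38));
      ((false, 2), (true, 3)); ((true, 2), (false, 36));
      ((false, 3), (true, 37)); ((true, 36), (false, 37));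
      ((false, 1), (false, 3)); ((false, 1), (false, 38));
      ((false, 3), (false, 36)); ((false, 36), (false, 38));
      ((true, 16), (true, 18)); ((true, 16), (true, 21));
      ((true, 17), (true, 19)); ((true, 19), (true, 22));
      ((true, 20), (true, 22)); ((true, 21), (true, 23));
      ((true, 18), (false, 19)); ((false, 20), (true, 21));
      ((false, 20), (true, 23)); ((false, 17), (false, 19));
      ((false, 20), (false, 22))].

Definition inner_pairs : seq vertex_pair :=
  [:: ((true, 1), (true, 3)); ((true, 1), (true, 36));
      ((true, 1), (true, 38)); ((true, 3), (true, 38));
      ((true, 36), (true, 38)); ((true, 17), (true, 19));
      ((true, 17), (true, 22)); ((true, 20), (true, 22))].

(** Each bit vector records which listed pairs a landmark fails to resolve. *)
Definition meeting (vs : seq bitseq) :=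
  allrel (fun v w => has (fun c => c.1 && c.2) (zip v w)) vs vs.

Lemma outer_pairsP :
  all valid outer_pairs && all (conflict true 0) outer_pairs &&
  meeting [seq map (conflict b t) outer_pairs |
            b <- [:: true; false], t <- iota 0 39].
Proof. by vm_compute. Qed.

Lemma inner_pairsP :
  all valid inner_pairs && all (conflict false 0) inner_pairs &&
  meeting [seq map (conflict b t) inner_pairs |
            b <- [:: false], t <- iota 0 39].
Proof. by vm_compute. Qed.

Lemma meetingP P A t u b c :
  meeting [seq map (conflict b t) P | b <- A, t <- iota 0 39] ->
  b \in A -> c \in A -> t < 39 -> u < 39 ->
  exists2 pq, pq \in P & conflict b t pq && conflict c u pq.
Proof.
move=> /allrelP meet bA cA t39 u39.
have mem d w : d \in A -> w < 39 ->
    map (conflict d w) P \in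
      [seq map (conflict b t) P | b <- A, t <- iota 0 39].
  by move=> dA w39; apply: allpairs_f; rewrite ?mem_iota.
have := meet _ _ (mem b t bA t39) (mem c u cA u39).
by rewrite zip_map has_map => /hasP[pq]; exists pq.
Qed.

Lemma stretch_lt m p : p < 39 -> stretch m p < 6 * (6 + m) + 3.
Proof. by rewrite /stretch; do ?case: ifP; lia. Qed.

Lemma stretch_inj m : injective (stretch m).
Proof. by move=> p q; rewrite /stretch; do ?case: ifP; lia. Qed.

Lemma common_pair m P A (x y z : petersen_vertex (6 * (6 + m) + 3)) :
  all valid P && all (conflict (outer x) 0) P &&
    meeting [seq map (conflict b t) P | b <- A, t <- iota 0 39] ->
  outer y \in A -> outer z \in A ->
  exists u v, u != v /\ forall w, w \in [:: x; y; z] ->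
    dist (petersen (6 * (6 + m) + 3) 3) w u =
    dist (petersen (6 * (6 + m) + 3) 3) w v.
Proof.
set n := 6 * (6 + m) + 3 in x y z *.
case/andP=> /andP[/allP val_P /allP x_P] meet yA zA.
have zx : zoom m (offset x x) = 0 by rewrite /offset leqnn subnn.
have zoom39 w : zoom m (offset x w) < 39 by apply/zoom_lt/offset_lt.
have [pq pqP /andP[y_pq z_pq]] := meetingP meet yA zA (zoom39 y) (zoom39 z).
have /andP[win pq_neq] := val_P _ pqP; have x_pq := x_P _ pqP.
case: pq => [[b p] [c q]] /= in pqP y_pq z_pq win pq_neq x_pq.
have [p39 q39] : p < 39 /\ q < 39 by move: win; rewrite /near /far; lia.
have [u [ou tu]] := offset_surj x b (stretch_lt m p39).
have [v [ov tv]] := offset_surj x c (stretch_lt m q39).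
exists u, v; split.
  apply: contra pq_neq => /eqP uv; move: ou tu.
  by rewrite uv ov tv => -> /stretch_inj ->.
have lift w : conflict (outer w) (zoom m (offset x w)) ((b, p), (c, q)) ->
    dist (petersen n 3) w u = dist (petersen n 3) w v.
  move=> /eqP /= w_pq; rewrite !petersen_dist // ou ov.
  rewrite !(pdist_offset _ _ x) tu tv.
  have [d [e [dm em grow]]] := gap_grown (offset_lt x w).
  have [[pn pf] [qn qf]] := (grow p, grow q).
  case/orP: win => /andP[p_in q_in].
    rewrite (pdist_grown _ _ dm (pn p_in)) w_pq.
    by rewrite (pdist_grown _ _ dm (qn q_in)).
  rewrite (pdist_grown _ _ em (pf p_in)) w_pq.
  by rewrite (pdist_grown _ _ em (qf q_in)).
by move=> w; rewrite !inE => /or3P[] /eqP ->; apply: lift; rewrite ?zx.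
Qed.

(** An outer landmark, if there is one, serves as the base; [inner_pairs] handles three inner
    ones. *)
Lemma three_landmarks m (x y z : petersen_vertex (6 * (6 + m) + 3)) :
  exists u v, u != v /\ forall w, w \in [:: x; y; z] ->
    dist (petersen (6 * (6 + m) + 3) 3) w u =
    dist (petersen (6 * (6 + m) + 3) 3) w v.
Proof.
have outerP a b c := @common_pair m outer_pairs [:: true; false] a b c.
have in2 (b : bool) : b \in [:: true; false] by case: b.
have [ox|nx] := boolP (outer x).
  by apply: outerP; rewrite ?in2 ?ox ?outer_pairsP.
have [oy|ny] := boolP (outer y).
  have [|||u [v [uv eq_uv]]] := outerP y x z; rewrite ?in2 ?oy ?outer_pairsP //.
  by exists u, v; split=> // w wW; apply: eq_uv; move: wW; rewrite !inE orbCA.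
have [oz|nz] := boolP (outer z).
  have [|||u [v [uv eq_uv]]] := outerP z x y; rewrite ?in2 ?oz ?outer_pairsP //.
  exists u, v; split=> // w wW; apply: eq_uv.
  by move: wW; rewrite !inE orbA orbC.
by apply: (@common_pair m inner_pairs [:: false]);
  rewrite ?inE ?(negbTE nx) ?(negbTE ny) ?(negbTE nz) ?inner_pairsP.
Qed.

Theorem theorem1 (n k : nat) (hn : n = 6 * k + 3) (hk : 6 <= k) :
  4 <= metric_dim (petersen n 3).
Proof.
rewrite hn -(subnKC hk); set m := k - 6.
rewrite /metric_dim.
case: ex_minnP => l /existsP[W /andP[_ /injectiveP injW]] _.
rewrite ltnNge; apply/negP => l3.
(* If [W] has fewer than three entries, [nth] pads with [x0]; a tie for the padded triple is still a
   tie for [W]. *)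
pose x0 : petersen_vertex (6 * (6 + m) + 3) := inl (inord 0).
have [u [v [/eqP uv eq_uv]]] :=
  three_landmarks (nth x0 W 0) (nth x0 W 1) (nth x0 W 2).
apply/uv/injW/eq_in_map => w /(nthP x0)[i + <-].
rewrite size_tuple => il; rewrite petersen_distC // [RHS]petersen_distC //.
apply: eq_uv.
by case: i il => [|[|[|i]]] il; rewrite !inE ?eqxx ?orbT //; lia.
Qed.
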